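(* Let $n\ge2$. For every non-empty $I\subseteq[n-1]$ and every $(r_0,\mathbf{r})\in\mathbb{N}_0\times\mathbb{N}^I$, we have $$h_n(I,r_0,\mathbf{r})=q^{\sum_{\iota\in I}r_\iota\,\iota(n-\iota)}\sum_{E\in\mathrm{L}_I(\mathfrak{o}/\mathfrak{m})}\tau_{I,E}\int\limits_{\substack{B\in\mathscr{B}_{I,r_0,\mathbf{r}}\\ \overline{B}=E}}|dB|,$$ where $\tau_{I,E}=\#\{\sigma\in\mathbb{S}_n:\ E\sigma\in\mathcal{R}_I(\mathfrak{o}/\mathfrak{m})\}$, and $\mathscr{B}_{I,r_0,\mathbf{r}}\subseteq\mathrm{L}_I(\mathfrak{o})$ is the subset of those $B$ satisfying the divisibility conditions $$\prod_{\substack{\iota\in I\\ j\le\iota<i}}\pi^{r_\iota}\ \Big|\ \pi^{r_0}\Bigl(\prod_{\substack{\iota\in I\\ i'\le\iota}}\pi^{r_\iota}\Bigr)\Bigl(\sum_{k=1}^{i}B_{ik}B_{i'k}(B^{-1})_{kj}\Bigr),\qquad 1\le j<i\le i'\le n.$$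
   Context: $\mathfrak{o}$ is a compact discrete valuation ring with maximal ideal $\mathfrak{m}=\pi\mathfrak{o}$ and $q=\#(\mathfrak{o}/\mathfrak{m})$. $[n-1]=\{1,\dots,n-1\}$, $\mathbb{N}=\{1,2,\dots\}$, $\mathbb{N}_0=\mathbb{N}\cup\{0\}$. $\mathfrak{o}^n$ carries componentwise multiplication; $\Lambda\le_s\mathfrak{o}^n$ means that $\Lambda$ is a finite-index $\mathfrak{o}$-submodule closed under multiplication. For non-empty $I=\{i_1<\dots<i_\ell\}\subseteq[n-1]$ and $(r_0,\mathbf{r})\in\mathbb{N}_0\times\mathbb{N}^I$, let $D(I,\mathbf{r})$ be the diagonal $n\times n$ matrix with $i$-th diagonal entry $\pi^{\sum_{\iota\in I,\iota\ge i}r_\iota}$. For a matrix $M$, $\langle M\rangle$ is the submodule generated by its rows. Write $\nu_0(\Lambda)=(I,r_0,\mathbf{r})$ if $\Lambda=\langle\pi^{r_0}D(I,\mathbf{r})A\rangle$ for some $A\in\mathrm{GL}_n(\mathfrak{o})$, and set $h_n(I,r_0,\mathbf{r})=\#\{\Lambda\le_s\mathfrak{o}^n:\nu_0(\Lambda)=(I,r_0,\mathbf{r})\}$. Put $i_0=0$, $i_{\ell+1}=n$. For a commutative ring $R$, $\mathrm{L}_I(R)$ is the group of block lower-triangular matrices in $\mathrm{GL}_n(R)$, for the block sizes $i_1,i_2-i_1,\dots,n-i_\ell$, whose diagonal blocks are identity matrices and whose blocks below the diagonal are arbitrary. $|dB|$ is the normalized Haar measure on the compact group $\mathrm{L}_I(\mathfrak{o})$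 (equivalently, the product of the normalized additive Haar measures of $\mathfrak{o}$ over the entries below the block diagonal), and $\overline{B}$ is reduction modulo $\mathfrak{m}$. For $E\in\mathrm{L}_I(\mathfrak{o}/\mathfrak{m})$ and $\sigma\in\mathbb{S}_n$, $E\sigma$ is the matrix obtained from $E$ by permuting its columns according to $\sigma$. $\mathcal{R}_I(\mathfrak{o}/\mathfrak{m})$ is the set of $I$-reduced matrices over the field $\mathfrak{o}/\mathfrak{m}$: those $A\in\mathrm{GL}_n(\mathfrak{o}/\mathfrak{m})$ such that (1) in each row the leftmost nonzero entry is $1$ (the leading $1$ of the row); (2) all entries above a leading $1$ are zero; (3) for each $j=0,\dots,\ell$, the leading $1$'s in rows $i_j+1,\dots,i_{j+1}$ occur in strictly increasing column positions. *)

(* Defs.v *)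
From HB Require Import structures.
From mathcomp Require Import all_boot all_order all_algebra perm finmap.
From mathcomp Require Import all_classical all_reals all_analysis.

Set Implicit Arguments.
Unset Strict Implicit.
Unset Printing Implicit Defensive.

Import Order.TTheory GRing.Theory Num.Theory.

Local Open Scope classical_set_scope.
Local Open Scope ring_scope.

(* Conventions.  Rows and columns are indexed from 0, so i : 'I_n is row i + 1
   of the usual 1-based numbering.  A subset of [n-1] = {1, .., n-1} is a set
   I : {set 'I_n} of nonzero ordinals, an element s of I standing for the
   integer s itself (no shift).  Hence a 1-based condition such as
   "iota >= i" becomes (i < s)%N, and "iota < i" becomes (s <= i)%N.
   A family in N^I is a function 'I_n -> nat that is positive on I; its values
   outside I are never used. *)

Section CompactDVR.

Definition dvdr (R : comNzRingType) (a b : R) : Prop := exists c, b = c * a.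

Record is_ideal (R : comNzRingType) (J : set R) : Prop := IsIdeal {
  ideal0 : J 0;
  idealD : forall x y, J x -> J y -> J (x + y);
  idealM : forall a x, J x -> J (a * x) }.

Definition principal_ideal (R : comNzRingType) (a : R) : set R :=
  [set x | dvdr a x].

Record maximal_ideal (R : comNzRingType) (M : set R) : Prop := MaximalIdeal {
  maximal_is_ideal : is_ideal M;
  maximal_proper : M <> [set: R];
  maximal_max : forall J, is_ideal J -> M `<=` J -> J = M \/ J = [set: R] }.

End CompactDVR.

#[short(type="topIdomainType")]
HB.structure Definition TopologicalIdomain :=
  {o of GRing.IntegralDomain o & Topological o}.

(* A discrete valuation ring is a principal ideal domain with exactly one
   maximal ideal, that ideal being nonzero; here it is generated by pi.
   The topology carried by o is required to be the pi-adic one. *)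
Record compact_dvr (o : topIdomainType) (pi : o) : Prop := CompactDvr {
  dvr_principal : forall J : set o, is_ideal J ->
    exists a, J = principal_ideal a;
  dvr_maximal : forall M : set o, maximal_ideal M <-> M = principal_ideal pi;
  dvr_uniformizer_neq0 : pi != 0;
  dvr_adic : forall (x : o) (U : set o),
    nbhs x U <-> exists k : nat, forall y, dvdr (pi ^+ k) (y - x) -> U y;
  dvr_compact : compact [set: o] }.

(* The residue field is presented by a surjective ring morphism with kernel
   the ideal generated by pi. *)
Record residue_map (o : comNzRingType) (pi : o) (k : fieldType)
    (red : {rmorphism o -> k}) : Prop := ResidueMap {
  residue_surj : forall a, exists x, red x = a;
  residue_ker : forall x, red x = 0 <-> dvdr pi x }.

Section Subalgebras.
Variables (o : topIdomainType) (n : nat).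
Implicit Types (L : set 'rV[o]_n) (I : {set 'I_n}) (r : 'I_n -> nat).

Definition rV_mul (x y : 'rV[o]_n) : 'rV[o]_n := \row_j (x 0 j * y 0 j).

Record submodule L : Prop := Submodule {
  submod0 : L 0;
  submodD : forall x y, L x -> L y -> L (x + y);
  submodZ : forall a x, L x -> L (a *: x) }.

Definition finite_index L : Prop :=
  finite_set (range (fun x : 'rV[o]_n => [set x + y | y in L])).

(* L <=_s o^n *)
Definition subalgebra L : Prop :=
  [/\ submodule L, finite_index L & forall x y, L x -> L y -> L (rV_mul x y)].

Definition row_span (M : 'M[o]_n) : set 'rV[o]_n := range (fun v => v *m M).

Definition Dmx (pi : o) I r : 'M[o]_n :=
  diag_mx (\row_i pi ^+ (\sum_(s in I | (i < s)%N) r s)).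

(* nu_0(L) = (I, r0, r) *)
Definition nu0_eq (pi : o) I (r0 : nat) r L : Prop :=
  exists2 A : 'M[o]_n, A \in unitmx & L = row_span (pi ^+ r0 *: Dmx pi I r *m A).

Definition h_set (pi : o) I (r0 : nat) r : set (set 'rV[o]_n) :=
  [set L | subalgebra L /\ nu0_eq pi I r0 r L].

Definition h_n (pi : o) I (r0 : nat) r : nat :=
  #|` fset_set (h_set pi I r0 r)|%fset.

End Subalgebras.

Section BlockTriangular.
Variables (n : nat) (I : {set 'I_n}).

(* Index (from 0) of the block containing i: the number of elements of I that
   are < i + 1. *)
Definition block (i : 'I_n) : nat := #|[pred s in I | (s <= i)%N]|.

Definition LImx (R : comUnitRingType) : pred 'M[R]_n := fun B =>
  (B \in unitmx) &&
  [forall i, forall j, (block i <= block j)%N ==> (B i j == (i == j)%:R)].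

Definition LI_group (R : comUnitRingType) := {B : 'M[R]_n | LImx B}.

Lemma LI1 (R : comUnitRingType) : LImx (1%:M : 'M[R]_n).
Proof.
rewrite /LImx unitmx1; apply/forallP => i; apply/forallP => j.
by apply/implyP => _; rewrite mxE.
Qed.

Lemma LI_mulmx (R : comUnitRingType) (A B : 'M[R]_n) :
  LImx A -> LImx B -> LImx (A *m B).
Proof.
move=> /andP[uA /forallP lA] /andP[uB /forallP lB].
have eA i j : (block i <= block j)%N -> A i j = (i == j)%:R.
  by move=> ij; apply/eqP; have /forallP/(_ j)/implyP := lA i; apply.
have eB i j : (block i <= block j)%N -> B i j = (i == j)%:R.
  by move=> ij; apply/eqP; have /forallP/(_ j)/implyP := lB i; apply.
rewrite /LImx unitmx_mul uA uB; apply/forallP => i; apply/forallP => j.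
apply/implyP => ij; rewrite mxE (bigD1 i)//= eA// eqxx mul1r (eB _ _ ij).
rewrite big1 ?addr0// => l li.
have [il|lt_li] := leqP (block i) (block l).
  by rewrite eA// eq_sym (negbTE li) mul0r.
have ltlj := leq_trans lt_li ij; rewrite (eB _ _ (ltnW ltlj)).
by case: eqP ltlj => [->|_ _]; rewrite ?ltnn ?mulr0.
Qed.

Definition LI_mul (R : comUnitRingType) (A B : LI_group R) : LI_group R :=
  exist _ (val A *m val B) (LI_mulmx (valP A) (valP B)).

HB.instance Definition _ (R : comUnitRingType) := Choice.on (LI_group R).
HB.instance Definition _ (R : comUnitRingType) :=
  isPointed.Build (LI_group R) (exist _ 1%:M (LI1 R)).

End BlockTriangular.

(* L_I(o) carries the subspace topology of 'M[o]_n. *)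
HB.instance Definition _ (n : nat) (I : {set 'I_n}) (o : topIdomainType) :=
  Topological.copy (LI_group I o)
    (initial_topology (val : LI_group I o -> 'M[o]_n)).

(* L_I(o) with its Borel sigma-algebra *)
Definition LI_borel (n : nat) (I : {set 'I_n}) (o : topIdomainType) :=
  g_sigma_algebraType (@open (LI_group I o)).

(* The normalization is part of the type of mu; L_I(o) is compact, so left
   invariance suffices. *)
Definition is_haar (R : realType) (n : nat) (I : {set 'I_n})
    (o : topIdomainType) (mu : probability (LI_borel I o) R) : Prop :=
  forall (B : LI_group I o) (S : set (LI_borel I o)),
    measurable S -> mu (LI_mul B @` S) = mu S.

Section Reduced.
Variables (n : nat) (I : {set 'I_n}) (k : finFieldType).
Implicit Types A E : 'M[k]_n.

Definition leading A (i j : 'I_n) : bool :=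
  (A i j != 0) && [forall j' : 'I_n, (j' < j)%N ==> (A i j' == 0)].

Definition I_reduced A : bool :=
  [&& A \in unitmx,
      [forall i, forall j, leading A i j ==> (A i j == 1)],
      [forall i, forall j, leading A i j ==>
         [forall i' : 'I_n, (i' < i)%N ==> (A i' j == 0)]] &
      [forall i : 'I_n, forall i' : 'I_n, forall j : 'I_n, forall j' : 'I_n,
         [&& (i < i')%N, block I i == block I i', leading A i j &
             leading A i' j'] ==> (j < j')%N]].

Definition tau E : nat := #|[pred s : 'S_n | I_reduced (col_perm s E)]|.

End Reduced.

Section Divisibility.
Variables (o : topIdomainType) (pi : o) (n : nat) (I : {set 'I_n}).
Variables (r0 : nat) (r : 'I_n -> nat).

Definition BI : set (LI_borel I o) := [set B |
  let M : 'M[o]_n := val (B : LI_group I o) in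
  forall j i i' : 'I_n, (j < i)%N -> (i <= i')%N ->
    dvdr (\prod_(s in I | (j < s)%N && (s <= i)%N) pi ^+ r s)
      (pi ^+ r0 * (\prod_(s in I | (i' < s)%N) pi ^+ r s)
        * (\sum_(l < n | (l <= i)%N) M i l * M i' l * invmx M l j))].

Definition reduces_to (k : fieldType) (red : {rmorphism o -> k})
    (E : 'M[k]_n) : set (LI_borel I o) :=
  [set B | map_mx red (val (B : LI_group I o)) = E].

End Divisibility.

Arguments BI {o} pi {n} I r0 r _.
Arguments reduces_to {o n} I {k} red E _.

(* Main.v *)
Require Import Defs.
From HB Require Import structures.
From mathcomp Require Import all_boot all_order all_algebra perm finmap.
From mathcomp Require Import all_classical all_reals all_analysis.
From mathcomp Require Import zify ring.

Set Implicit Arguments.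
Unset Strict Implicit.
Unset Printing Implicit Defensive.

Import Order.TTheory GRing.Theory Num.Theory.

Local Open Scope classical_set_scope.
Local Open Scope ring_scope.

(* Lattices of type [(I, r0, r)] are the row spans of [pi^r0 D A], and such a
   span only depends on the coset of [A] modulo the group of the [G] in
   [GL_n(o)] with [D G D^-1] integral, i.e. with [pi^(gap i j) | G_ij] where
   [gap i j] sums the [r_s] with [j < s <= i].  Row reduction by block upper
   triangular matrices brings [A] into the form [B s] with [B] in [L_I(o)], [s] a
   permutation, and the reduction of [B s] modulo [pi] [I]-reduced; then [s] and
   the coset of [B] modulo [K = {X in L_I(o) : pi^(gap i j) | X_ij}] are uniquely
   determined.  Permuting columns is an algebra automorphism, so the lattice is
   a subalgebra iff that of [B] is, which is the divisibility condition on [B].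
   Finally a right coset of [K] has Haar measure [1 / N], where
   [N = q^(sum_ij gap i j)] is the number of cosets. *)

(** * Rigidity of permutations under monotonicity *)

(** Reindexing by [s] leaves the sum of [f] unchanged, so no termwise inequality can be strict. *)
Lemma perm_ge_eq (T : finType) (f : T -> nat) (s : {perm T}) :
  (forall i, f i <= f (s i))%N -> forall i, f (s i) = f i.
Proof.
move=> le_f i.
have sumE : (\sum_i f i = \sum_i f (s i))%N := reindex_inj (@perm_inj _ s).
have [_] := @leqif_sum _ predT (fun i => f i == f (s i)) f (fun i => f (s i))
  (fun j _ => leqif_eq (le_f j)).
by rewrite sumE eqxx => /esym/forallP/(_ i)/eqP.
Qed.

Lemma perm_mono_id n (s : 'S_n) :
  (forall i j : 'I_n, i < j -> s i < s j)%N -> s = 1%g.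
Proof.
move=> s_mono; have le_s : forall m (i : 'I_n), val i = m -> (i <= s i)%N.
  elim=> [|m IHm] i im; first by rewrite im.
  have lt_mn : (m < n)%N by rewrite (leq_trans _ (ltn_ord i))// im.
  rewrite im (leq_ltn_trans (IHm (Ordinal lt_mn) erefl))//.
  by apply: s_mono; rewrite /= im.
apply/permP => i; apply/val_inj; rewrite perm1.
by apply: (@perm_ge_eq _ val) => j; exact: le_s.
Qed.

(** * Block triangular matrices over a commutative ring *)

Section BlockForms.
Variables (n : nat) (I : {set 'I_n}).

Lemma block_le (i j : 'I_n) : (i <= j)%N -> (block I i <= block I j)%N.
Proof.
move=> le_ij; apply/subset_leq_card/fintype.subsetP => s; rewrite !inE.
by case/andP=> -> /leq_trans->.
Qed.

Lemma block_lt (i j : 'I_n) : (block I i < block I j)%N -> (i < j)%N.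
Proof. by rewrite !ltnNge; exact/contra/block_le. Qed.

Section CommutativeRing.
Variable R : comUnitRingType.
Implicit Types B C G : 'M[R]_n.

Definition uppermx G := forall i j, (block I j < block I i)%N -> G i j = 0.

Lemma uppermxM G G' : uppermx G -> uppermx G' -> uppermx (G *m G').
Proof.
move=> up up' i j lt_ji; rewrite mxE big1// => l _.
have [lt_li|le_il] := ltnP (block I l) (block I i); first by rewrite up// mul0r.
by rewrite up' ?mulr0// (leq_trans lt_ji).
Qed.

Lemma LImxE B : LImx I B -> forall i j, (block I i <= block I j)%N ->
  B i j = (i == j)%:R.
Proof.
by case/andP=> _ /forallP B_I i j ij; apply/eqP;
  move/forallP/(_ j)/implyP: (B_I i); exact.
Qed.

(** These entries make [B] lower unitriangular, so its determinant is 1. *)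
Lemma LImx_intro B :
  (forall i j, (block I i <= block I j)%N -> B i j = (i == j)%:R) -> LImx I B.
Proof.
move=> BE; apply/andP; split; last first.
  by apply/forallP => i; apply/forallP => j; apply/implyP => ?; rewrite BE.
rewrite unitmxE det_trig; last first.
  apply/is_trig_mxP => i j lt_ij; rewrite BE; last exact/block_le/ltnW.
  by case: eqP lt_ij => // ->; rewrite ltnn.
by rewrite big1 ?unitr1// => i _; rewrite BE ?eqxx.
Qed.

Lemma LImx_unit B : LImx I B -> B \in unitmx.
Proof. by case/andP. Qed.

Lemma LImx_lower B (i j : 'I_n) : LImx I B -> (i < j)%N -> B i j = 0.
Proof.
move=> B_I lt_ij; rewrite (LImxE B_I) ?(block_le (ltnW lt_ij))//.
by case: eqP lt_ij => // ->; rewrite ltnn.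
Qed.

(** Descending induction on the column [j]: in entry [(i, j)] of [G *m B], an index [l] in a block
    after that of [j] contributes nothing by induction, and any other [l != j] has [B l j = 0]. *)
Lemma LImx_quot G B : LImx I B -> LImx I (G *m B) -> LImx I G.
Proof.
move=> B_I GB_I; apply: LImx_intro => i j; have [m] := ubnP (n - j).
elim: m j => // m IHm j le_jm le_ij; rewrite -(LImxE GB_I le_ij) mxE.
rewrite (bigD1 j)//= (LImxE B_I)// eqxx mulr1 big1 ?addr0// => l ne_lj.
have [le_lj|lt_jl] := leqP (block I l) (block I j).
  by rewrite (LImxE B_I)// (negbTE ne_lj) mulr0.
have lt_jl' := block_lt lt_jl.
rewrite IHm ?(leq_trans le_ij (ltnW lt_jl))//; last first.
  by have := ltn_ord l; lia.
by case: eqP lt_jl le_ij => [->|]; rewrite ?mul0r// => /leq_trans h /h; rewrite ltnn.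
Qed.

Lemma LImx_inv B : LImx I B -> LImx I (invmx B).
Proof.
by move=> B_I; apply: (LImx_quot B_I); rewrite mulVmx ?LI1// LImx_unit.
Qed.

Lemma upper_LI_id G : uppermx G -> LImx I G -> G = 1%:M.
Proof.
move=> G_up G_I; apply/matrixP => i j; rewrite mxE.
have [/(LImxE G_I)//|lt_ji] := leqP (block I i) (block I j).
by rewrite G_up//; case: eqP lt_ji => // ->; rewrite ltnn.
Qed.

(** Padding by the identity keeps the size [n]; the determinant is the trailing minor of [C] that
    starts at block [c]. *)
Definition trailmx (c : nat) C : 'M[R]_n :=
  \matrix_(i, j) if (c <= block I i)%N && (c <= block I j)%N then C i j
                 else (i == j)%:R.

(* Row [i] of [U] solves the linear system given by the trailing minor that
   starts at the block of [i]. *)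
Lemma upper_LI_factor C : (forall c, trailmx c C \in unitmx) ->
  exists2 U, uppermx U & LImx I (U *m C).
Proof.
move=> unitC; pose V i := invmx (trailmx (block I i) C).
exists (\matrix_(i, j) if (block I i <= block I j)%N then V i i j else 0).
  by move=> i j lt_ji; rewrite mxE leqNgt lt_ji.
apply: LImx_intro => i j le_ij.
have := mulVmx (unitC (block I i)); move/matrixP/(_ i j); rewrite !mxE => <-.
apply: eq_bigr => l _; rewrite !mxE le_ij andbT; case: ifPn => [//|].
by case: eqP => [->|_ _]; rewrite ?le_ij// mulr0 mul0r.
Qed.

End CommutativeRing.

(** * Leading positions and [I]-reduced forms over a finite field *)

Section Field.
Variable k : finFieldType.
Implicit Types A E G : 'M[k]_n.

Lemma leadingE A i j : leading A i j ->
  A i j != 0 /\ forall j' : 'I_n, (j' < j)%N -> A i j' = 0.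
Proof.
by case/andP=> ? /forallP h; split=> // j' /(implyP (h j'))/eqP.
Qed.

Lemma leading_intro A i j : A i j != 0 ->
  (forall j' : 'I_n, (j' < j)%N -> A i j' = 0) -> leading A i j.
Proof.
by move=> nz h; apply/andP; split=> //; apply/forallP=> j'; apply/implyP=> /h->.
Qed.

Lemma leading_inj A i j j' : leading A i j -> leading A i j' -> j = j'.
Proof.
move=> /leadingE[nz h] /leadingE[nz' h']; apply/val_inj/eqP.
by case: ltngtP => // [/h' e|/h e]; move: nz nz'; rewrite e eqxx.
Qed.

Lemma leading_exists A i : A \in unitmx -> exists j, leading A i j.
Proof.
move=> uA; have [j nz] : exists j, A i j != 0.
  apply/existsP; apply: contraLR uA; rewrite negb_exists => /forallP A0.
  rewrite unitmxE unitfE negbK (expand_det_row _ i) big1// => j _.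
  by move: (A0 j); rewrite negbK => /eqP->; rewrite mul0r.
case: (@arg_minnP _ j (fun j => A i j != 0) val nz) => l nzl lmin.
exists l; apply: leading_intro => // j' lt_j'l; apply/eqP.
by apply: contraTT lt_j'l => /lmin; rewrite -leqNgt.
Qed.

(** The default [i] is reached only on a zero row, hence never for an invertible matrix. *)
Definition lead A i : 'I_n := odflt i [pick j | leading A i j].

Lemma leadP A i : A \in unitmx -> leading A i (lead A i).
Proof.
move=> /(leading_exists i)[j lj]; rewrite /lead; case: pickP => [//|].
by move=> /(_ j); rewrite lj.
Qed.

Lemma lead_eq A i j : leading A i j -> lead A i = j.
Proof.
move=> lj; rewrite /lead; case: pickP => [l /leading_inj/(_ lj)->//|].
by move=> /(_ j); rewrite lj.
Qed.

(* The first column met by a combination of rows with distinct leading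
   positions is one of these positions. *)
Lemma lead_upper G A (p : 'I_n -> 'I_n) i : injective p ->
  (forall l, leading A l (p l)) -> uppermx G -> G *m A \in unitmx ->
  exists2 l, (block I i <= block I l)%N & leading (G *m A) i (p l).
Proof.
move=> inj_p Ap G_up uGA; have [j lj] := leading_exists i uGA.
have [l0 nz0] : exists l, G i l != 0.
  apply/existsP; apply: contraTT (leadingE lj).1; rewrite negb_exists negbK.
  move=> /forallP G0; rewrite mxE big1// => l _.
  by move: (G0 l); rewrite negbK => /eqP->; rewrite mul0r.
case: (@arg_minnP _ l0 (fun l => G i l != 0) (fun l => p l) nz0) => l nzl lmin.
have le_pl m : m != l -> G i m * A m (p l) = 0.
  move=> ne_ml; have [->|/lmin le_lm] := eqVneq (G i m) 0; first by rewrite mul0r.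
  rewrite (leadingE (Ap m)).2 ?mulr0//= ltn_neqAle le_lm andbT.
  by apply: contra ne_ml => /eqP/val_inj/inj_p->.
exists l; first by rewrite leqNgt; apply: contra nzl => /G_up->.
apply: leading_intro.
  rewrite mxE (bigD1 l)//= big1 ?addr0//.
  exact: mulf_neq0 nzl (leadingE (Ap l)).1.
move=> j' lt_j'; rewrite mxE big1// => m _.
have [->|/lmin le_lm] := eqVneq (G i m) 0; first by rewrite mul0r.
by rewrite (leadingE (Ap m)).2 ?mulr0//= (leq_trans lt_j').
Qed.

Lemma addmx_delta_unit (i i' : 'I_n) (c : k) : i != i' ->
  (1%:M + c *: delta_mx i i' : 'M[k]_n) \in unitmx.
Proof.
move=> ne; apply: (@mulmx1_unit _ _ _ (1%:M - c *: delta_mx i i') _).1.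
rewrite mulmxDl mul1mx mulmxBr mulmx1 -scalemxAl -scalemxAr.
by rewrite mul_delta_mx_0 1?eq_sym// !scaler0 subr0 subrK.
Qed.

Definition sorted_in_blocks (p : 'I_n -> 'I_n) := forall i i' : 'I_n,
  (i < i')%N -> block I i = block I i' -> (p i < p i')%N.

(* Maximize [\sum_i i.+1 * lead i] over the orbit of [A] under the block upper
   triangular group: a repeated leading position in two rows could be pushed to
   the right in one of them, and two rows of a block in the wrong order could be
   exchanged. *)
Lemma exists_sorted_leads A : A \in unitmx ->
  exists G, [/\ uppermx G, G \in unitmx, injective (lead (G *m A))
             & sorted_in_blocks (lead (G *m A))].
Proof.
move=> uA.
(* Boolean membership in the finite group over which the maximum is taken. *)
pose ok G := (G \in unitmx) && [forall i, forall j, (block I j < block I i)%N ==>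
  (G i j == 0)].
have okP G : ok G -> uppermx G.
  by case/andP=> _ /forallP h i j ij; apply/eqP; move/forallP/(_ j)/implyP: (h i); exact.
have ok1 G : G \in unitmx -> uppermx G -> ok G.
  move=> uG h; rewrite /ok uG; apply/forallP => i; apply/forallP => j.
  by apply/implyP => /h->.
have ok_id : ok 1%:M.
  apply: ok1; rewrite ?unitmx1// => i j; rewrite mxE.
  by case: eqP => // ->; rewrite ltnn.
pose F G := (\sum_(i < n) lead (G *m A) i * i.+1)%N.
case: (@arg_maxnP _ _ _ F ok_id) => G okG Gmax; exists G.
have upG := okP _ okG; have /andP[uG _] := okG.
have uGA : G *m A \in unitmx by rewrite unitmx_mul uG.
have maxE H : H \in unitmx -> uppermx H -> (F (H *m G) <= F G)%N.
  by move=> uH upH; apply/Gmax/ok1; [rewrite unitmx_mul uH|exact: uppermxM].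
have inj_ord i i' : lead (G *m A) i = lead (G *m A) i' ->
    (block I i <= block I i')%N -> i = i'.
  move=> e le_b; apply/eqP; apply: contraT => ne.
  have [/leadingE[nz z] /leadingE[nz' z']] := (leadP i uGA, leadP i' uGA).
  set j := lead (G *m A) i in e nz z; rewrite -e in nz' z'.
  (* This [c] cancels the shared leading entry, so the leading position of row [i] moves right while
     the other rows stay unchanged. *)
  pose c := - ((G *m A) i j / (G *m A) i' j).
  pose H : 'M[k]_n := 1%:M + c *: delta_mx i i'.
  have uH : H \in unitmx by exact: addmx_delta_unit.
  have upH : uppermx H.
    move=> a b lt_ba; rewrite !mxE; case: eqP lt_ba => [->|_]; first by rewrite ltnn.
    have [->|_] := eqVneq a i; last by rewrite mulr0 addr0.
    have [->|_] := eqVneq b i'; last by rewrite mulr0 addr0.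
    by rewrite ltnNge le_b.
  have uHGA : H *m (G *m A) \in unitmx by rewrite unitmx_mul uH.
  have HE a b : (H *m (G *m A)) a b =
      (G *m A) a b + (if a == i then c * (G *m A) i' b else 0).
    rewrite /H mulmxDl mul1mx -scalemxAl mxE; congr (_ + _).
    rewrite mxE mxE (bigD1 i')//= big1 ?addr0; last first.
      by move=> l nl; rewrite mxE (negbTE nl) andbF mul0r.
    by rewrite mxE eqxx andbT; case: eqP => _; rewrite ?mul1r// mul0r mulr0.
  have same a : a != i -> lead (H *m (G *m A)) a = lead (G *m A) a.
    move=> na; apply: lead_eq; have /leadingE[nza za] := leadP a uGA.
    by apply: leading_intro => [|b /za]; rewrite HE (negbTE na) addr0.
  have incr : (j < lead (H *m (G *m A)) i)%N.
    rewrite ltnNge; apply/negP => le_lj.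
    have /leadingE[nzl zl] := leadP i uHGA.
    move: nzl; rewrite HE eqxx.
    move: le_lj; rewrite leq_eqVlt => /orP[/eqP/val_inj->|lt_lj].
      by rewrite /c mulNr divfK// subrr eqxx.
    by rewrite z// z'// mulr0 addr0 eqxx.
  have := maxE _ uH upH; rewrite /F (bigD1 i)//= [X in (_ <= X)%N](bigD1 i)//=.
  rewrite -mulmxA; under eq_bigr => a na do rewrite same//.
  by rewrite leq_add2r leq_pmul2r// leqNgt incr.
split=> //.
  move=> i i' e; have [le|/ltnW le] := leqP (block I i) (block I i').
    exact: inj_ord.
  by apply/esym/inj_ord.
move=> i i' lt_ii' eb; rewrite ltnNge leq_eqVlt; apply/negP => /orP[/eqP/val_inj e|lt_l].
  by move: lt_ii'; rewrite (inj_ord i i') ?eb// ltnn.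
have ne : i' != i by apply: contraTneq lt_ii' => ->; rewrite ltnn.
pose H : 'M[k]_n := tperm_mx i i'.
have uH : H \in unitmx by exact: unitmx_perm.
have upH : uppermx H.
  move=> a b lt_ba; rewrite !mxE; case: eqP lt_ba => // <-.
  by case: tpermP => [->|->|]; rewrite ?eb ltnn.
have HE a b : (H *m (G *m A)) a b = (G *m A) (tperm i i' a) b.
  by rewrite /H /tperm_mx -row_permE mxE.
have leadH a : lead (H *m (G *m A)) a = lead (G *m A) (tperm i i' a).
  apply: lead_eq; have /leadingE[nza za] := leadP (tperm i i' a) uGA.
  by apply: leading_intro => [|b /za]; rewrite HE.
have := maxE _ uH upH; rewrite /F -mulmxA.
rewrite (bigD1 i)//= (bigD1 i')//= [X in (_ <= X)%N](bigD1 i)//=.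
rewrite [X in (_ <= _ + X)%N](bigD1 i')//= !leadH tpermL tpermR.
under eq_bigr => a /andP[na na'] do rewrite leadH tpermD 1?eq_sym//.
rewrite !addnA leq_add2r leqNgt => /negP; apply.
(* The exchange raises the sum by the product of two positive differences, one of leading positions
   and one of row indices. *)
move: lt_l lt_ii'; move: (nat_of_ord (lead _ i)) (nat_of_ord (lead _ i')).
move: (nat_of_ord i) (nat_of_ord i') => x y a b lt_ba lt_xy.
by rewrite -(subnKC lt_ba) -(subnKC lt_xy); nia.
Qed.

(** Sorting rows and columns by leading position gives an upper triangular matrix with nonzero
    diagonal, and the identity padding preserves this shape. *)
Lemma trail_leads_unit A (p : 'S_n) c : (forall i, leading A i (p i)) ->
  trailmx c (col_perm p A) \in unitmx.
Proof.
move=> Ap; set M := trailmx _ _; pose q := (p^-1)%g.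
suff : (row_perm q (col_perm q M))^T \in unitmx.
  rewrite unitmx_tr row_permE unitmx_mul => /andP[_].
  by rewrite col_permE unitmx_mul => /andP[].
have M0 i j : (p j < p i)%N -> M i j = 0.
  move=> lt_ji; rewrite !mxE; case: ifP => _; first exact: (leadingE (Ap i)).2.
  by case: eqP lt_ji => // ->; rewrite ltnn.
rewrite unitmxE unitfE det_trig; last first.
  by apply/is_trig_mxP => i j lt_ij; rewrite 3!mxE M0// /q !permKV.
apply/prodf_neq0 => i _; rewrite 5!mxE; case: ifP => _.
  by rewrite (leadingE (Ap _)).1.
by rewrite eqxx oner_eq0.
Qed.

Lemma I_reducedE A : I_reduced I A -> [/\ A \in unitmx,
  forall i j, leading A i j -> A i j = 1,
  forall i j, leading A i j -> forall i' : 'I_n, (i' < i)%N -> A i' j = 0 &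
  forall i i' j j' : 'I_n, (i < i')%N -> block I i = block I i' ->
    leading A i j -> leading A i' j' -> (j < j')%N].
Proof.
case/and4P=> uA /'forall_forallP h1 /'forall_forallP h2 h3; split=> //.
- by move=> i j l; apply/eqP; exact: (implyP (h1 i j)).
- by move=> i j l i' lt; apply/eqP; move: (implyP (h2 i j) l) =>
  /forallP/(_ i')/implyP; exact.
- move=> i i' j j' lt eb l l'; move/forallP: h3 => /(_ i)/forallP/(_ i').
  move=> /forallP/(_ j)/forallP/(_ j')/implyP; apply.
  by rewrite lt eb eqxx l.
Qed.

(** By [lead_upper], row [i] of [G *m A] has its leading entry at some [p l] with [l] in the block
    of [i] or a later one; there the [L_I] factor vanishes unless [l = i]. So the leading positions
    are still given by [p], and the unitriangular factor supplies the 1's and the zeros above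
    them. *)
Lemma I_reduced_intro G A (p : 'S_n) : (forall i, leading A i (p i)) ->
  sorted_in_blocks p -> uppermx G -> LImx I (G *m col_perm p A) ->
  I_reduced I (G *m A).
Proof.
move=> Ap p_sorted G_up E_I; set E := _ *m _ in E_I; set A' := G *m A.
have A'E i j : A' i (p j) = E i j.
  by rewrite !mxE; apply: eq_bigr => l _; rewrite !mxE.
have uA' : A' \in unitmx.
  have := LImx_unit E_I; rewrite /E col_permE mulmxA unitmx_mul => /andP[] //.
have A'p i : leading A' i (p i).
  have [l le_il ll] := lead_upper i (@perm_inj _ p) Ap G_up uA'.
  have [] := leadingE ll; rewrite -/A' A'E (LImxE E_I)//.
  by have [e|_] := eqVneq i l; rewrite ?eqxx// [in p i]e.
have pE i j : leading A' i j -> j = p i by move/leading_inj; exact.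
apply/and4P; split=> //.
- apply/'forall_forallP => i j; apply/implyP => /pE->.
  by rewrite A'E (LImxE E_I) ?eqxx.
- apply/'forall_forallP => i j; apply/implyP => /pE->.
  apply/forallP => i'; apply/implyP => lt_i'i; rewrite A'E.
  by rewrite (LImx_lower E_I lt_i'i).
- apply/forallP => i; apply/forallP => i'; apply/forallP => j; apply/forallP => j'.
  by apply/implyP => /and4P[lt /eqP eb /pE-> /pE->]; exact: p_sorted.
Qed.

(** The leading column [j] of row [i] satisfies [s j <= i]; if [s j < i], the diagonal 1 of row
    [s j] of [E] would lie above a leading 1. *)
Lemma reduced_leading E (s : 'S_n) i : LImx I E ->
  I_reduced I (col_perm s E) -> leading (col_perm s E) i (s^-1%g i).
Proof.
move=> E_I /I_reducedE[uA h1 h2 h3].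
have [j lj] := leading_exists i uA; rewrite -[i in s^-1%g i](_ : s j = i) ?permK//.
apply/val_inj/eqP; rewrite eqn_leq leqNgt.
have [nz z] := leadingE lj; rewrite mxE in nz.
have -> /= : ~~ (i < s j)%N by apply: contra nz => /(LImx_lower E_I)->.
rewrite leqNgt; apply/negP => lt_ji; have := h2 _ _ lj _ lt_ji.
by rewrite mxE (LImxE E_I)// eqxx => /eqP; rewrite oner_eq0.
Qed.

(** The permutation [t] matches rows with the same leading column. By [lead_upper] it never lowers
    the block, so it preserves blocks; inside a block the leading columns increase on both sides, so
    [t] is increasing, hence trivial. *)
Lemma I_reduced_uniq G E E' (s s' : 'S_n) : uppermx G -> LImx I E -> LImx I E' ->
  I_reduced I (col_perm s E) -> I_reduced I (col_perm s' E') ->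
  G *m col_perm s E = col_perm s' E' -> s = s'.
Proof.
move=> G_up E_I E'_I red red' GE.
have [uA' _ _ sorted'] := I_reducedE red'; have [_ _ _ sorted] := I_reducedE red.
have lE i := reduced_leading i E_I red; have lE' i := reduced_leading i E'_I red'.
pose t : 'S_n := (s'^-1 * s)%g.
have tE i : (s^-1)%g (t i) = (s'^-1)%g i by rewrite permM permK.
have le_t i : (block I i <= block I (t i))%N.
  have uGE : G *m col_perm s E \in unitmx by rewrite GE.
  have [l le_il] := lead_upper i (@perm_inj _ s^-1%g) lE G_up uGE.
  by rewrite GE => /(leading_inj (lE' i)); rewrite -tE => /perm_inj->.
have eq_t := @perm_ge_eq _ (block I) t le_t.
suff t1 : t = 1%g.
  by apply/esym/invg_inj/permP => i; rewrite -tE t1 perm1.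
apply: perm_mono_id => i j lt_ij.
have := block_le (ltnW lt_ij); rewrite leq_eqVlt => /orP[/eqP eb|]; last first.
  by rewrite -(eq_t i) -(eq_t j); exact: block_lt.
have := sorted' _ _ _ _ lt_ij eb (lE' i) (lE' j); rewrite -!tE => lt_q.
rewrite ltnNge leq_eqVlt; apply/negP => /orP[/eqP/val_inj e|lt_t].
  by rewrite e ltnn in lt_q.
have := sorted _ _ _ _ lt_t _ (lE (t j)) (lE (t i)); rewrite !eq_t eb => /(_ erefl).
by rewrite ltnNge (ltnW lt_q).
Qed.

End Field.
End BlockForms.

(** * Divisibility in a commutative ring *)

Section Divides.
Variable R : comNzRingType.
Implicit Types a b c d : R.

Lemma dvdr0 a : dvdr a 0.
Proof. by exists 0; rewrite mul0r. Qed.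

Lemma dvd1r b : dvdr 1 b.
Proof. by exists b; rewrite mulr1. Qed.

Lemma dvdrr a : dvdr a a.
Proof. by exists 1; rewrite mul1r. Qed.

Lemma dvdrD a b c : dvdr a b -> dvdr a c -> dvdr a (b + c).
Proof. by move=> [x ->] [y ->]; exists (x + y); rewrite mulrDl. Qed.

Lemma dvdr_mull a b c : dvdr a b -> dvdr a (c * b).
Proof. by move=> [x ->]; exists (c * x); rewrite mulrA. Qed.

Lemma dvdr_mulr a b c : dvdr a b -> dvdr a (b * c).
Proof. by rewrite mulrC; exact: dvdr_mull. Qed.

Lemma dvdrN a b : dvdr a b -> dvdr a (- b).
Proof. by rewrite -mulN1r; exact: dvdr_mull. Qed.

Lemma dvdrB a b c : dvdr a b -> dvdr a c -> dvdr a (b - c).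
Proof. by move=> ab /dvdrN; exact: dvdrD. Qed.

Lemma dvdr_sum (T : Type) (s : seq T) (P : pred T) a (F : T -> R) :
  (forall i, P i -> dvdr a (F i)) -> dvdr a (\sum_(i <- s | P i) F i).
Proof. by move=> aF; apply: big_ind => //; [exact: dvdr0|exact: dvdrD]. Qed.

Lemma dvdr_trans a b c : dvdr a b -> dvdr b c -> dvdr a c.
Proof. by move=> ab [x ->]; exact: dvdr_mull. Qed.

Lemma dvdr_exp a m n : (m <= n)%N -> dvdr (a ^+ m) (a ^+ n).
Proof. by move=> le_mn; exists (a ^+ (n - m)); rewrite -exprD subnK. Qed.

End Divides.

Lemma dvdr_mul2l (R : idomainType) (a b c : R) : a != 0 ->
  dvdr (a * b) (a * c) <-> dvdr b c.
Proof.
move=> a0; split=> [[x e]|[x ->]]; exists x; last by rewrite mulrCA.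
by apply: (mulfI a0); rewrite e mulrCA.
Qed.

(** * Units and truncated [pi]-adic expansions *)

Section Residue.
Variables (o : topIdomainType) (pi : o) (o_dvr : compact_dvr pi).
Variables (k : fieldType) (red : {rmorphism o -> k}).
Variable red_residue : residue_map pi red.

Lemma red_eq0 x : red x = 0 <-> dvdr pi x.
Proof. exact: residue_ker. Qed.

Lemma red_pi : red pi = 0.
Proof. by apply/red_eq0; exact: dvdrr. Qed.

Lemma pi_exp_neq0 m : pi ^+ m != 0.
Proof. exact/expf_neq0/(dvr_uniformizer_neq0 o_dvr). Qed.

(** By Zorn's lemma a nonunit lies in a maximal ideal; the only one is generated by [pi] and is the
    kernel of [red]. *)
Lemma red_unit x : red x != 0 -> x \is a GRing.unit.
Proof.
move=> nz; apply/negPn/negP => nu.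
have ideal_x : is_ideal (principal_ideal x).
  split; [exact: dvdr0|exact: dvdrD|move=> a y; exact: dvdr_mull].
pose P (J : set o) := J = set0 \/ [/\ is_ideal J, J x & ~ J 1].
have [F FP F_total|M [[M0|[M_id Mx M1]] M_max]] := @Zorn_bigcup _ P.
- have [F0|/existsNP[J0 /not_implyP[FJ0 /eqP/set0P[y0 J0y0]]]] :=
    EM (forall J, F J -> J = set0).
    by left; rewrite -subset0 => y [J /F0->].
  have idF J y : F J -> J y -> [/\ is_ideal J, J x & ~ J 1].
    by move=> /FP[->|].
  right; split.
  + split.
    * by exists J0 => //; have [[]] := idF _ _ FJ0 J0y0.
    * move=> y z [J FJ Jy] [J' FJ' J'z].
      have [[Jid _ _] [J'id _ _]] := (idF _ _ FJ Jy, idF _ _ FJ' J'z).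
      have [sub|sub] := F_total _ _ FJ FJ'.
        by exists J' => //; apply: (idealD J'id) => //; exact: sub.
      by exists J => //; apply: (idealD Jid) => //; exact: sub.
    * move=> a y [J FJ Jy]; exists J => //.
      by have [Jid _ _] := idF _ _ FJ Jy; exact: idealM.
  + by exists J0 => //; have [] := idF _ _ FJ0 J0y0.
  + by move=> [J FJ J1]; have [_ _] := idF _ _ FJ J1.
- have /(_ (principal_ideal x)) := M_max; apply.
    by rewrite M0; split=> [y []|/(_ x)]; apply; exact: dvdrr.
  right; split=> //; first exact: dvdrr.
  move=> [c e]; case/negP: nu; apply/unitrPr; exists c.
  by rewrite mulrC.
- have : maximal_ideal M.
    split=> //; first by move=> e; apply: M1; rewrite e.
    move=> J J_id MJ; have [JM|nJM] := EM (J `<=` M).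
      by left; rewrite eqEsubset.
    right; rewrite -subTset => y _.
    suff J1 : J 1 by rewrite -[y]mulr1; exact: idealM.
    apply: contrapT => nJ1; apply: (M_max J) => //.
    by right; split=> //; exact: MJ.
  move=> /(dvr_maximal o_dvr) Mpi; move: Mx; rewrite Mpi => /red_eq0 e.
  by rewrite e eqxx in nz.
Qed.

Lemma map_unitmx_red n (M : 'M[o]_n) :
  map_mx red M \in unitmx -> M \in unitmx.
Proof. by rewrite !unitmxE unitfE det_map_mx; exact: red_unit. Qed.

Lemma red_unitmx n (M : 'M[o]_n) : M \in unitmx -> map_mx red M \in unitmx.
Proof. by rewrite !unitmxE det_map_mx; exact: rmorph_unit. Qed.

Variables (sec : k -> o) (secK : cancel sec red).

(** Since [sec] is a mere set-theoretic section, these representatives modulo [pi ^+ m] need not be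
    closed under addition. *)
Definition digits m (a : 'I_m -> k) : o := \sum_(l < m) sec (a l) * pi ^+ l.

Lemma digitsS m (a : 'I_m.+1 -> k) :
  digits a = sec (a ord0) + digits (fun l => a (lift ord0 l)) * pi.
Proof.
rewrite /digits big_ord_recl mulr1 mulr_suml; congr (_ + _).
by apply: eq_bigr => l _; rewrite -mulrA -exprSr.
Qed.

(** The lowest digit is [red x]; the remainder is a multiple of [pi], whose cofactor is expanded
    recursively. *)
Lemma digits_surj m x : exists a : 'I_m -> k, dvdr (pi ^+ m) (x - digits a).
Proof.
elim: m x => [|m IHm] x; first by exists (fun=> 0); exact: dvd1r.
have /red_eq0[y xE] : red (x - sec (red x)) = 0 by rewrite rmorphB/= secK subrr.
have [a [c yE]] := IHm y.
exists (fun l => if unlift ord0 l is Some l' then a l' else red x).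
exists c; rewrite digitsS unlift_none opprD addrA xE.
have -> : digits (fun l : 'I_m =>
    if unlift ord0 (lift ord0 l) is Some l' then a l' else red x) = digits a.
  by apply: eq_bigr => l _; rewrite liftK.
by rewrite -mulrBl yE -mulrA -exprSr.
Qed.

(** Reduction modulo [pi] identifies the lowest digits, after which one factor [pi] cancels. *)
Lemma digits_inj m (a b : 'I_m -> k) :
  dvdr (pi ^+ m) (digits a - digits b) -> a =1 b.
Proof.
elim: m a b => [|m IHm] a b; first by move=> _ [].
rewrite !digitsS => ab_dvd; have e0 : a ord0 = b ord0.
  have /red_eq0 : dvdr pi (sec (a ord0) + digits (fun l => a (lift ord0 l)) * pi
      - (sec (b ord0) + digits (fun l => b (lift ord0 l)) * pi)).
    by apply: dvdr_trans ab_dvd; rewrite exprS; apply: dvdr_mulr; exact: dvdrr.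
  rewrite rmorphB !rmorphD !rmorphM/= red_pi !mulr0 !addr0 !secK.
  by move/eqP; rewrite subr_eq0 => /eqP.
have eS : (fun l => a (lift ord0 l)) =1 (fun l => b (lift ord0 l)).
  apply: IHm; apply/(dvdr_mul2l _ _ (dvr_uniformizer_neq0 o_dvr)).
  move: ab_dvd; rewrite e0 exprS.
  by rewrite opprD addrACA subrr add0r -mulrBl [_ * pi]mulrC.
by move=> l; case: (unliftP ord0 l) => [l'|] ->; [exact: eS|].
Qed.

End Residue.

(** * Exponents of the diagonal matrix and their gaps *)

Section Gap.
Variables (n : nat) (I : {set 'I_n}) (r : 'I_n -> nat).

(** For [j <= i], the valuation of the quotient of the diagonal entries [j] and [i] of [D]; for
    [i <= j] it is 0. *)
Definition gap (i j : 'I_n) : nat := \sum_(s in I | (j < s <= i)%N) r s.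

Definition dexp (i : 'I_n) : nat := \sum_(s in I | (i < s)%N) r s.

Lemma dexp_gap (i j : 'I_n) : (j <= i)%N -> dexp j = (gap i j + dexp i)%N.
Proof.
move=> le_ji; rewrite /dexp (bigID (fun s : 'I_n => (s <= i)%N))/=.
congr (_ + _)%N; apply: eq_bigl => s; first by rewrite -andbA.
by rewrite -ltnNge -andbA; congr (_ && _); lia.
Qed.

Lemma gap_eq0 (i j : 'I_n) : (block I i <= block I j)%N -> gap i j = 0%N.
Proof.
move=> le_ij; rewrite /gap big1// => s /and3P[Is lt_js le_si].
suff : (block I j < block I i)%N by rewrite ltnNge le_ij.
apply/proper_card/properP; split.
  apply/fintype.subsetP => t; rewrite !inE => /andP[->] /= le_tj.
  by rewrite (leq_trans le_tj)// (leq_trans (ltnW lt_js)).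
by exists s; rewrite !inE ?Is ?le_si//= -ltnNge.
Qed.

(** A zero gap leaves no element of [I] between [j] and [i], since each would contribute a positive
    [r s]. *)
Lemma gap_gt0 (i j : 'I_n) : (forall s, s \in I -> 0 < r s)%N ->
  (block I j < block I i)%N -> (0 < gap i j)%N.
Proof.
move=> r_pos; rewrite lt0n; apply: contraTneq => gap0; rewrite -leqNgt.
apply/subset_leq_card/fintype.subsetP => s; rewrite !inE => /andP[Is le_si].
rewrite Is/= leqNgt; apply/negP => lt_js.
move: gap0; rewrite /gap (bigD1 s) ?Is ?lt_js//= => /eqP.
by rewrite addn_eq0 -leqn0 leqNgt r_pos.
Qed.

Lemma gap_le (i j : 'I_n) : (gap i j <= \sum_(s in I) r s)%N.
Proof. by rewrite [leqRHS](bigID (fun s : 'I_n => (j < s <= i)%N))/= leq_addr. Qed.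

Lemma dexp_le (i : 'I_n) : (dexp i <= \sum_(s in I) r s)%N.
Proof. by rewrite [leqRHS](bigID (fun s : 'I_n => (i < s)%N))/= leq_addr. Qed.

(** Each [s] contributes [r s] once per pair with [j < s <= i], and there are [s * (n - s)] such
    pairs. *)
Lemma sum_gap : (\sum_(p : 'I_n * 'I_n) gap p.1 p.2 =
  \sum_(s in I) r s * s * (n - s))%N.
Proof.
transitivity (\sum_(p : 'I_n * 'I_n) \sum_(s in I)
    (if p.2 < s <= p.1 then r s else 0))%N.
  by apply: eq_bigr => p _; rewrite /gap -big_mkcondr.
rewrite exchange_big/=; apply: eq_bigr => s _; rewrite -big_mkcond/=.
rewrite sum_nat_const -mulnA mulnC; congr (_ * _)%N.
have cardlt : #|[pred j : 'I_n | (j < s)%N]| = s.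
  rewrite -sum1_card (eq_bigl (fun j : 'I_n => (j < s)%N))//.
  by rewrite (big_ord_narrow (ltnW (ltn_ord s))) sum1_card card_ord.
have -> : (n - s = #|[pred i : 'I_n | (s <= i)%N]|)%N.
  rewrite -[n in (n - _)%N]card_ord -(cardC [pred j : 'I_n | (j < s)%N]) cardlt addKn.
  by apply: eq_card => j; rewrite !inE -leqNgt.
rewrite -[X in (X * _)%N]cardlt mulnC -cardX; apply: eq_card => p.
by rewrite !inE andbC.
Qed.

End Gap.

(** * Row-span lattices, their stabilizer and closure under multiplication *)

Section Lattices.
Variables (o : topIdomainType) (pi : o) (o_dvr : compact_dvr pi).
Variables (n : nat) (I : {set 'I_n}) (r : 'I_n -> nat).
Implicit Types A B G X M : 'M[o]_n.

Let D := Dmx pi I r.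

Lemma Dmx_mul A i j : (D *m A) i j = pi ^+ dexp I r i * A i j.
Proof. by rewrite mul_diag_mx !mxE. Qed.

Lemma mul_Dmx A i j : (A *m D) i j = A i j * pi ^+ dexp I r j.
Proof. by rewrite mul_mx_diag !mxE. Qed.

Definition stabmx G := forall i j, dvdr (pi ^+ gap I r i j) (G i j).

(** Entry [(i, j)] reads [pi^(dexp i) G_ij = X_ij pi^(dexp j)]. As [dexp] is nonincreasing, this is
    solvable in [X_ij] exactly under the gap divisibility, which is vacuous above the diagonal. *)
Lemma stabmxP G : stabmx G <-> exists X, D *m G = X *m D.
Proof.
split=> [G_st|[X e] i j].
  have : forall p : 'I_n * 'I_n, exists x,
      pi ^+ dexp I r p.1 * G p.1 p.2 = x * pi ^+ dexp I r p.2.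
    move=> [i j] /=; have [le_ji|/ltnW le_ij] := leqP j i.
      have [x ->] := G_st i j; exists x; rewrite (dexp_gap _ _ le_ji) exprD; ring.
    exists (pi ^+ gap I r j i * G i j).
    by rewrite (dexp_gap _ _ le_ij) exprD; ring.
  move=> /choice[X XE]; exists (\matrix_(i, j) X (i, j)).
  by apply/matrixP => i j; rewrite Dmx_mul mul_Dmx mxE (XE (i, j)).
have /matrixP/(_ i j) := e; rewrite Dmx_mul mul_Dmx.
have [le_ji|lt_ij] := leqP j i.
  rewrite (dexp_gap _ _ le_ji) exprD => eij; exists (X i j).
  by apply: (mulfI (pi_exp_neq0 o_dvr (dexp I r i))); rewrite eij; ring.
by rewrite gap_eq0 ?(block_le _ (ltnW lt_ij))// expr0 => _; exact: dvd1r.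
Qed.

Lemma Dmx_det_neq0 : \det D != 0.
Proof.
by rewrite det_diag; apply/prodf_neq0 => i _; rewrite mxE (pi_exp_neq0 o_dvr).
Qed.

Lemma stabmx_unit_intertwine G X : G \in unitmx -> D *m G = X *m D ->
  X \in unitmx.
Proof.
move=> uG /(congr1 determinant); rewrite !det_mulmx mulrC.
by move/(mulIf Dmx_det_neq0) => e; rewrite unitmxE -e -unitmxE.
Qed.

Lemma stabmxM G G' : stabmx G -> stabmx G' -> stabmx (G *m G').
Proof.
move=> /stabmxP[X e] /stabmxP[X' e']; apply/stabmxP; exists (X *m X').
by rewrite mulmxA e -mulmxA e' mulmxA.
Qed.

Lemma stabmxV G : G \in unitmx -> stabmx G -> stabmx (invmx G).
Proof.
move=> uG /stabmxP[X e]; apply/stabmxP; exists (invmx X).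
have uX := stabmx_unit_intertwine uG e.
by rewrite -[LHS](mulKmx uX) [X *m _]mulmxA -e mulmxK.
Qed.

Lemma stabmx_upper G : uppermx I G -> stabmx G.
Proof.
move=> G_up i j; have [le_ij|/G_up->] := leqP (block I i) (block I j).
  by rewrite gap_eq0// expr0; exact: dvd1r.
exact: dvdr0.
Qed.

Lemma stabmx_red_upper (k : fieldType) (red : {rmorphism o -> k}) G :
  residue_map pi red -> (forall s, s \in I -> 0 < r s)%N -> stabmx G ->
  uppermx I (map_mx red G).
Proof.
move=> res r_pos G_st i j /(gap_gt0 r_pos) gap_pos; rewrite mxE.
apply/(residue_ker res); apply: dvdr_trans (G_st i j).
by rewrite -{1}[pi]expr1; exact: dvdr_exp.
Qed.

Lemma row_spanM X M : row_span (X *m M) `<=` row_span M.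
Proof. by move=> _ [v _ <-]; exists (v *m X) => //; rewrite mulmxA. Qed.

Lemma row_span_unit X M : X \in unitmx -> row_span (X *m M) = row_span M.
Proof.
move=> uX; apply/seteqP; split; first exact: row_spanM.
by rewrite -{1}[M](mulKmx uX); exact: row_spanM.
Qed.

Lemma row_span_sub M M' : row_span M `<=` row_span M' -> exists X, M = X *m M'.
Proof.
move=> sub; have : forall i, exists v, row i M = v *m M'.
  move=> i; have [|v _ <-] := sub (row i M); last by exists v.
  by exists (delta_mx 0 i) => //; rewrite rowE.
move=> /choice[V VE]; exists (\matrix_i V i).
by apply/row_matrixP => i; rewrite row_mul rowK VE.
Qed.

Lemma row_span_submodule M : submodule (row_span M).
Proof.
split; first by exists 0; rewrite ?mul0mx.
  by move=> _ _ [v _ <-] [w _ <-]; exists (v + w) => //; rewrite mulmxDl.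
by move=> a _ [v _ <-]; exists (a *: v) => //; rewrite scalemxAl.
Qed.

Variable r0 : nat.

Definition lattice A : set 'rV[o]_n := row_span (pi ^+ r0 *: D *m A).

(** Moving [G] across [D] turns it into an invertible left factor, which preserves the row span. *)
Lemma lattice_stab G A : G \in unitmx -> stabmx G -> lattice (G *m A) = lattice A.
Proof.
move=> uG /stabmxP[X e]; have uX := stabmx_unit_intertwine uG e.
rewrite /lattice -[RHS](row_span_unit _ uX) !mulmxA.
by rewrite -scalemxAr -e scalemxAl.
Qed.

(** An inclusion of spans gives [D A' = X D A] once [pi ^+ r0] is cancelled, so [X] intertwines
    [A' *m invmx A]. *)
Lemma lattice_inj A A' : A \in unitmx -> lattice A' = lattice A ->
  stabmx (A' *m invmx A).
Proof.
move=> uA e; have [|X XE] := @row_span_sub (pi ^+ r0 *: D *m A') (pi ^+ r0 *: D *m A).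
  by rewrite -/(lattice A) -e.
apply/stabmxP; exists X; rewrite mulmxA.
suff -> : D *m A' = X *m D *m A by rewrite mulmxK.
apply/matrixP => i j; move/matrixP/(_ i j): XE.
rewrite -!scalemxAl -scalemxAr mulmxA.
have scaleE (C : 'M[o]_n) : (pi ^+ r0 *: C) i j = pi ^+ r0 * C i j by rewrite mxE.
rewrite !scaleE.
exact: (mulfI (pi_exp_neq0 o_dvr r0)).
Qed.

(** In coordinates relative to the rows of [A], the lattice is a product of ideals. *)
Lemma latticeE A v : A \in unitmx -> lattice A v <->
  forall j, dvdr (pi ^+ (r0 + dexp I r j)) ((v *m invmx A) 0 j).
Proof.
move=> uA; split=> [[w _ <-] j|].
  rewrite -!mulmxA mulmxV// mulmx1 -scalemxAr mxE mul_mx_diag !mxE.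
  by exists (w 0 j); rewrite exprD; ring.
move=> /choice[w wE]; exists (\row_j w j) => //.
rewrite mulmxA -[RHS](mulmxKV uA); congr (_ *m _).
apply/rowP => j; rewrite wE -scalemxAr mxE mul_mx_diag !mxE exprD; ring.
Qed.

Definition mul_closed (L : set 'rV[o]_n) :=
  forall x y, L x -> L y -> L (rV_mul x y).

Lemma rV_mulC (x y : 'rV[o]_n) : rV_mul x y = rV_mul y x.
Proof. by apply/rowP => j; rewrite !mxE mulrC. Qed.

Lemma row_span_closed M : (forall i i' : 'I_n, (i <= i')%N ->
    row_span M (rV_mul (row i M) (row i' M))) -> mul_closed (row_span M).
Proof.
move=> rows_M _ _ [v _ <-] [w _ <-].
have [M0 MD MZ] := row_span_submodule M.
have -> : rV_mul (v *m M) (w *m M) =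
    \sum_i \sum_i' (v 0 i * w 0 i') *: rV_mul (row i M) (row i' M).
  apply/rowP => j; rewrite !mxE summxE mulr_suml; apply: eq_bigr => i _.
  rewrite summxE mulr_sumr; apply: eq_bigr => i' _; rewrite !mxE; ring.
apply: big_ind => // i _; apply: big_ind => // i' _; apply: MZ.
have [|/ltnW] := leqP i i'; first exact: rows_M.
by rewrite rV_mulC; exact: rows_M.
Qed.

Lemma lattice_col_perm (s : 'S_n) A v :
  lattice (col_perm s A) (col_perm s v) <-> lattice A v.
Proof.
rewrite /lattice !col_permE mulmxA.
split=> -[w _ e]; exists w => //; last by rewrite mulmxA e.
by move: e; rewrite mulmxA => /(can_inj (mulmxK (unitmx_perm _ _))).
Qed.

Lemma mul_closed_col_perm (s : 'S_n) A :
  mul_closed (lattice (col_perm s A)) <-> mul_closed (lattice A).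
Proof.
have permM x y : col_perm s (rV_mul x y) = rV_mul (col_perm s x) (col_perm s y).
  by apply/rowP => j; rewrite !mxE.
have permK x : col_perm s (col_perm s^-1%g x) = x :> 'rV[o]_n.
  by apply/rowP => j; rewrite !mxE permK.
split=> A_cl x y.
  move=> /(lattice_col_perm s) Lx /(lattice_col_perm s) Ly.
  by apply/(lattice_col_perm s); rewrite permM; exact: A_cl.
rewrite -[x]permK -[y]permK => /lattice_col_perm Lx /lattice_col_perm Ly.
by rewrite -permM; apply/lattice_col_perm; exact: A_cl.
Qed.

Lemma finite_index_lattice (k : finFieldType) (red : {rmorphism o -> k}) A :
  residue_map pi red -> A \in unitmx -> finite_index (lattice A).
Proof.
move=> res uA; have [sec secK] := choice (residue_surj res).
(* This [m] bounds every diagonal exponent, so the lattice contains [pi ^+ m] times the full module,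
   and vectors of [m]-digit expansions represent all cosets. *)
set m := (r0 + \sum_(s in I) r s)%N.
have [L0 LD LZ] := row_span_submodule (pi ^+ r0 *: D *m A).
have LN x : lattice A x -> lattice A (- x) by rewrite -scaleN1r; exact: LZ.
pose F (a : {ffun 'I_n * 'I_m -> k}) : set 'rV[o]_n :=
  [set \row_j digits pi sec (fun l => a (j, l)) + y | y in lattice A].
apply: (@sub_finite_set _ _ [set F a | a in [set: {ffun 'I_n * 'I_m -> k}]]).
  move=> _ [x _ <-].
  have /choice[a aP] : forall j, exists a : 'I_m -> k,
      dvdr (pi ^+ m) (x 0 j - digits pi sec a) by move=> j;
        exact: digits_surj res _ secK _ _.
  exists [ffun p => a p.1 p.2] => //; rewrite /F; set z := \row_j _.
  have zx : lattice A (x - z).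
    apply/latticeE => // j; rewrite mxE; apply: dvdr_sum => l _.
    apply/dvdr_mulr/(@dvdr_trans _ _ (pi ^+ m)).
      by apply: dvdr_exp; rewrite leq_add2l dexp_le.
    rewrite !mxE; have -> // : digits pi sec (fun l0 => [ffun p =>
      a p.1 p.2] (l, l0)) = digits pi sec (a l).
    by apply: eq_bigr => ? _; rewrite ffunE.
  apply/seteqP; split=> _ [y Ly <-].
    exists (y - (x - z)); first exact: LD (LN _ zx).
    by rewrite opprB addrCA [x + _]addrC subrK addrC.
  exists (y + (x - z)); first exact: LD.
  by rewrite addrCA [z + _]addrC subrK addrC.
exact/finite_image/finite_finset.
Qed.

Definition BI_cond B := forall j i i' : 'I_n, (j < i)%N -> (i <= i')%N ->
  dvdr (\prod_(s in I | (j < s)%N && (s <= i)%N) pi ^+ r s)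
    (pi ^+ r0 * (\prod_(s in I | (i' < s)%N) pi ^+ r s)
      * (\sum_(l < n | (l <= i)%N) B i l * B i' l * invmx B l j)).

(** It suffices to multiply generating rows [i <= i']. In the basis [B], coordinate [j] of the
    product is [pi^(r0 + dexp i) pi^(r0 + dexp i')] times the sum in the condition, which stops at
    [i] because [B] is lower triangular. Membership asks for [pi^(r0 + dexp j)], and cancelling
    [pi^(r0 + dexp i)] leaves the gap. *)
Lemma BI_mul_closed B : LImx I B -> BI_cond B <-> mul_closed (lattice B).
Proof.
move=> B_I; have uB := LImx_unit B_I.
pose M := pi ^+ r0 *: D *m B.
pose S (i i' j : 'I_n) := \sum_(l < n | (l <= i)%N) B i l * B i' l * invmx B l j.
have prodE (P : pred 'I_n) : \prod_(s in I | P s) pi ^+ r s =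
    pi ^+ \sum_(s in I | P s) r s by rewrite expr_sum.
have ME a l : M a l = pi ^+ (r0 + dexp I r a) * B a l.
  by rewrite /M -scalemxAl mxE Dmx_mul exprD mulrA.
have entry i i' j : (rV_mul (row i M) (row i' M) *m invmx B) 0 j =
    pi ^+ (r0 + dexp I r i) * (pi ^+ (r0 + dexp I r i') * S i i' j).
  rewrite mxE /S [in RHS]big_mkcond !mulr_sumr; apply: eq_bigr => l _.
  rewrite mxE [row i M 0 l]mxE [row i' M 0 l]mxE !ME.
  case: leqP => [_|lt_il]; first ring.
  by rewrite (LImx_lower B_I lt_il); ring.
have condE (i i' : 'I_n) : (i <= i')%N ->
    lattice B (rV_mul (row i M) (row i' M)) <->
    forall j : 'I_n, (j < i)%N ->
    dvdr (pi ^+ gap I r i j) (pi ^+ (r0 + dexp I r i') * S i i' j).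
  move=> le_ii'; rewrite latticeE//; split=> h j.
    move=> lt_ji; have := h j; rewrite entry (dexp_gap _ _ (ltnW lt_ji)).
    by rewrite addnCA addnC exprD; move/(dvdr_mul2l _ _ (pi_exp_neq0 o_dvr _)).
  rewrite entry; have [lt_ji|le_ij] := ltnP j i.
    rewrite (dexp_gap _ _ (ltnW lt_ji)) addnCA addnC exprD.
    by apply/(dvdr_mul2l _ _ (pi_exp_neq0 o_dvr _)); exact: h.
  (* For [j >= i] the divisibility is automatic, as [dexp j <= dexp i]. *)
  apply: dvdr_mulr; apply: dvdr_exp; rewrite leq_add2l.
  by rewrite (dexp_gap _ _ le_ij) leq_addl.
split=> [B_BI|B_cl].
  apply: row_span_closed => i i' le_ii'; apply/(condE _ _ le_ii') => j lt_ji.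
  by have := B_BI j i i' lt_ji le_ii'; rewrite !prodE -exprD.
move=> j i i' lt_ji le_ii'; rewrite !prodE -exprD.
have rowL a : lattice B (row a M) by exists (delta_mx 0 a) => //; rewrite rowE.
by apply: (condE i i' le_ii').1 => //; exact: B_cl.
Qed.

End Lattices.

(** * Cardinality of images and measure of finite disjoint unions *)

Lemma card_fset_set_image (T : finType) (U : choiceType) (P : pred T)
    (f : T -> U) : {in P &, injective f} ->
  #|` fset_set (f @` [set x | P x])|%fset = #|P|.
Proof.
move=> f_inj; have -> : f @` [set x | P x] = [set` (imfset imfset_key f (mem P))].
  apply/seteqP; split=> [_ [x Px <-]|y /imfsetP[x Px ->]]; last by exists x.
  by rewrite /=; apply/imfsetP; exists x.
rewrite set_fsetK card_in_imfset// cardE; apply/perm_size/uniq_perm.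
- exact: enum_finmem_uniq.
- exact: enum_uniq.
- by move=> x; rewrite enum_finmemE.
Qed.

Lemma measure_bigcup_fin d (T : measurableType d) (R : realType)
    (mu : {measure set T -> \bar R}) (J : finType) (P : pred J) (F : J -> set T) :
  (forall a, measurable (F a)) -> trivIset setT F ->
  mu (\bigcup_(a in [set a | P a]) F a) = (\sum_(a in P) mu (F a))%E.
Proof.
move=> mF tF; rewrite (bigcup_pred P) big_enum_val [RHS]big_enum_val.
rewrite measure_bigsetU_ord// => i j _ _ /(tF _ _ I I).
exact: enum_val_inj.
Qed.

(** * Representatives of the cosets of [K] *)

Section Representatives.
Variables (o : topIdomainType) (pi : o) (o_dvr : compact_dvr pi).
Variables (k : finFieldType) (red : {rmorphism o -> k}).
Variable red_residue : residue_map pi red.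
Variables (sec : k -> o) (secK : cancel sec red).
Variables (n : nat) (I : {set 'I_n}) (r : 'I_n -> nat).
Implicit Types B X : 'M[o]_n.

(** One slot per entry and per digit below its gap; entries with zero gap, among them the diagonal
    ones, receive no digit. *)
Definition gap_index : finType := {p : 'I_n * 'I_n & 'I_(gap I r p.1 p.2)}.

Definition rep_digits : finType := {ffun gap_index -> k}.

Lemma card_rep_digits :
  #|rep_digits| = (#|k| ^ (\sum_(s in I) r s * s * (n - s)))%N.
Proof.
rewrite card_ffun card_tagged -sum_gap; congr (_ ^ _)%N.
rewrite sumnE big_map big_enum/=; apply: eq_bigr => p _.
by rewrite card_ord.
Qed.

Definition rep_entry (a : rep_digits) (i j : 'I_n) : 'I_(gap I r i j) -> k :=
  fun l => a (@Tagged _ (i, j) (fun p => 'I_(gap I r p.1 p.2)) l).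

Definition repmx (a : rep_digits) : 'M[o]_n :=
  \matrix_(i, j) ((i == j)%:R + digits pi sec (@rep_entry a i j)).

Lemma digits_eq0 m (a : 'I_m -> k) : m = 0%N -> digits pi sec a = 0.
Proof. by move=> m0; subst m; rewrite /digits big_ord0. Qed.

Lemma repmx_LI a : LImx I (repmx a).
Proof.
apply: LImx_intro => i j le_ij; rewrite mxE digits_eq0 ?addr0//.
exact: gap_eq0.
Qed.

(* Reduce the columns one at a time, starting from the last one. *)
Lemma repmx_exists B : LImx I B ->
  exists X a, [/\ LImx I X, stabmx pi I r X & X *m B = repmx a].
Proof.
move=> B_I.
(* Invariant: the last [m] columns of [X *m B] already have the form of a representative. *)
have step m : (m <= n)%N -> exists X, [/\ LImx I X, stabmx pi I r X &
    forall i j : 'I_n, (n - m <= j)%N -> exists d : 'I_(gap I r i j) -> k,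
      (X *m B) i j = (i == j)%:R + digits pi sec d].
  elim: m => [_|m IHm lt_mn].
    exists 1%:M; split; first exact: LI1.
      apply: stabmx_upper => i j; rewrite mxE.
      by case: eqP => // ->; rewrite ltnn.
    by move=> i j; rewrite subn0 leqNgt ltn_ord.
  have [X [X_I X_st XB]] := IHm (ltnW lt_mn).
  have lt_j0 : (n - m.+1 < n)%N by lia.
  pose j0 : 'I_n := Ordinal lt_j0.
  have /fin_all_exists[d dP] : forall i, exists d : 'I_(gap I r i j0) -> k,
      dvdr (pi ^+ gap I r i j0) ((X *m B) i j0 - (i == j0)%:R - digits pi sec d).
    by move=> i; exact: digits_surj red_residue _ secK _ _.
  (* [y] is the excess of column [j0] over its allowed digits. As [B] is lower unitriangular,
     subtracting [Y *m B] removes exactly [y] from that column and leaves the later ones intact. *)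
  pose y i := (X *m B) i j0 - (i == j0)%:R - digits pi sec (d i).
  pose Y : 'M[o]_n := \matrix_(i, j) (y i *+ (j == j0)).
  have XB_I : LImx I (X *m B) by exact: LI_mulmx.
  exists (X - Y); split.
  - apply: LImx_intro => i j le_ij; rewrite 3!mxE (LImxE X_I)//.
    have [ej|_] := eqVneq j j0; last by rewrite mulr0n subr0.
    rewrite mulr1n /y (LImxE XB_I) -?ej// subrr digits_eq0 ?subr0//.
    by rewrite -ej gap_eq0.
  - move=> i j; rewrite 3!mxE; apply: dvdrB => //.
    by have [->|_] := eqVneq j j0; [exact: dP|exact: dvdr0].
  - move=> i j le_j; have YB : (Y *m B) i j = y i * B j0 j.
      rewrite mxE (bigD1 j0)//= big1 ?addr0; last first.
        by move=> l ne; rewrite mxE (negbTE ne) mul0r.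
      by rewrite mxE eqxx.
    have subE (M N : 'M[o]_n) : (M - N) i j = M i j - N i j by rewrite !mxE.
    rewrite mulmxBl subE YB.
    have [->|ne] := eqVneq j j0.
      exists (d i); rewrite (LImxE B_I)// eqxx mulr1 /y; ring.
    have lt_j0j : (j0 < j)%N.
      rewrite ltn_neqAle (leq_trans _ le_j)//= andbT.
      by apply: contra ne => /eqP e; apply/eqP/val_inj.
    rewrite (LImx_lower B_I lt_j0j) mulr0 subr0; apply: XB.
    by move: lt_j0j => /=; lia.
have [X [X_I X_st XB]] := step n (leqnn n).
have /fin_all_exists[d dP] : forall p : 'I_n * 'I_n, exists d : 'I_(gap I r p.1 p.2) -> k,
    (X *m B) p.1 p.2 = (p.1 == p.2)%:R + digits pi sec d.
  by move=> [i j]; apply: XB; rewrite subnn.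
exists X, [ffun t : gap_index => d (tag t) (tagged t)]; split=> //.
apply/matrixP => i j; rewrite (dP (i, j)) mxE; congr (_ + _).
by apply: eq_bigr => l _; rewrite /rep_entry ffunE.
Qed.

(** Descending induction on columns: if row [i] of [X] agrees with the identity to the right of [j],
    then [X i j] minus its identity value is a difference of two expansions divisible by
    [pi^(gap i j)], so the digits agree and the difference is 0. *)
Lemma repmx_uniq X a b : LImx I X -> stabmx pi I r X ->
  X *m repmx a = repmx b -> a = b.
Proof.
move=> X_I X_st Xab.
have stepE (i j : 'I_n) : (forall l : 'I_n, (j < l)%N -> X i l = (i == l)%:R) ->
    X i j - (i == j)%:R = digits pi sec (@rep_entry b i j) -
      digits pi sec (@rep_entry a i j).
  move=> Xl; have := congr1 (fun M : 'M[o]_n => M i j) Xab; rewrite [in RHS]mxE mxE.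
  have [e|ne] := eqVneq i j.
    subst j; rewrite (LImxE X_I)// !digits_eq0 ?gap_eq0// eqxx.
    by rewrite !subrr.
  rewrite (bigD1 j)//= (bigD1 i)//= [repmx a j j]mxE [repmx a i j]mxE.
  rewrite (LImxE X_I (leqnn _)) !eqxx (negbTE ne) [digits _ _ (@rep_entry a j j)]digits_eq0 ?gap_eq0//.
  rewrite big1 => [e|l /andP[ne_lj ne_li]].
    by move: e; rewrite /= !add0r !addr0 mul1r mulr1 => <-; ring.
  have [lt_jl|le_lj] := ltnP j l.
    by rewrite Xl// eq_sym (negbTE ne_li) mul0r.
  rewrite (LImx_lower (repmx_LI a)) ?mulr0//.
  by rewrite ltn_neqAle le_lj andbT.
have eq_digits (i j : 'I_n) : (forall l : 'I_n, (j < l)%N -> X i l = (i == l)%:R) ->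
    @rep_entry a i j =1 @rep_entry b i j.
  move=> Xl; apply: (digits_inj o_dvr red_residue secK).
  rewrite -opprB -stepE//; apply/dvdrN.
  have [le_ij|lt_ji] := leqP (block I i) (block I j).
    by rewrite gap_eq0// expr0; exact: dvd1r.
  case: eqP lt_ji => [->|_ _]; first by rewrite ltnn.
  by rewrite subr0; exact: X_st.
have X1 (i j : 'I_n) : X i j = (i == j)%:R.
  have [m] := ubnP (n - j); elim: m j => // m IHm j le_jm.
  have Xl (l : 'I_n) : (j < l)%N -> X i l = (i == l)%:R.
    by move=> lt_jl; apply: IHm; have := ltn_ord l; lia.
  apply/eqP; rewrite -subr_eq0 stepE//; apply/eqP.
  by apply/eqP; rewrite subr_eq0; apply/eqP/eq_bigr => l _; rewrite eq_digits.
apply/ffunP => -[[i j] l]; exact: (eq_digits i j (fun _ _ => X1 _ _) l).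
Qed.

End Representatives.

(** * Enumeration of the lattices that are subalgebras *)

Section Enumeration.
Variables (o : topIdomainType) (pi : o) (o_dvr : compact_dvr pi).
Variables (k : finFieldType) (red : {rmorphism o -> k}).
Variable red_residue : residue_map pi red.
Variables (sec : k -> o) (secK : cancel sec red).
Variables (n : nat) (I : {set 'I_n}) (r0 : nat) (r : 'I_n -> nat).
Variable r_pos : forall s, s \in I -> (0 < r s)%N.
Implicit Types A B X : 'M[o]_n.

Let rep (a : rep_digits k I r) : 'M[o]_n := repmx pi sec a.

Lemma map_LImx B : LImx I B -> LImx I (map_mx red B).
Proof.
move=> B_I; apply: LImx_intro => i j le_ij.
by rewrite mxE (LImxE B_I)// rmorph_nat.
Qed.

(** The residue matrix is first brought to distinct sorted leading positions, and that row operation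
    is lifted to [o]. After permuting columns, the trailing minors are units modulo [pi], hence
    units, and [upper_LI_factor] applies. *)
Lemma LI_reduction A : A \in unitmx -> exists G (s : 'S_n) B,
  [/\ uppermx I G, G \in unitmx, LImx I B, G *m A = col_perm s B
    & I_reduced I (col_perm s (map_mx red B))].
Proof.
move=> uA; have u_rA := red_unitmx red uA.
have [G0 [G0_up uG0 inj_p p_sorted]] := exists_sorted_leads I u_rA.
pose p : 'S_n := perm inj_p.
pose A0 := G0 *m map_mx red A.
have uA0 : A0 \in unitmx by rewrite unitmx_mul uG0.
have A0p i : leading A0 i (p i) by rewrite permE; exact: leadP.
(* Zeros are imposed below the block diagonal because [sec 0] need not be 0. *)
pose G : 'M[o]_n := \matrix_(i, j)
  if (block I i <= block I j)%N then sec (G0 i j) else 0.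
have redG : map_mx red G = G0.
  apply/matrixP => i j; rewrite !mxE; case: leqP => [_|/G0_up->].
    exact: secK.
  exact: rmorph0.
have G_up : uppermx I G by move=> i j lt_ji; rewrite mxE leqNgt lt_ji.
have uG : G \in unitmx.
  by apply: (map_unitmx_red o_dvr red_residue); rewrite redG.
have redGA : map_mx red (G *m A) = A0 by rewrite map_mxM redG.
have [c|U U_up B_I] := @upper_LI_factor n I _ (col_perm p (G *m A)).
  apply: (map_unitmx_red o_dvr red_residue).
  rewrite (_ : map_mx _ _ = trailmx I c (col_perm p (map_mx red (G *m A)))).
    by rewrite redGA; exact: trail_leads_unit.
  apply/matrixP => i j; rewrite [LHS]mxE [in LHS]mxE [RHS]mxE.
  by case: ifP => _; [rewrite !mxE|rewrite rmorph_nat].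
pose B := U *m col_perm p (G *m A).
have BE : U *m (G *m A) = col_perm p^-1%g B.
  by rewrite /B !col_permE invgK -!mulmxA -perm_mxM mulVg perm_mx1 mulmx1.
exists (U *m G), p^-1%g, B; split=> //.
- exact: uppermxM.
- rewrite unitmx_mul uG andbT.
  by have := LImx_unit B_I; rewrite unitmx_mul => /andP[].
- by rewrite -mulmxA.
- rewrite -map_col_perm -BE map_mxM redGA; apply: (@I_reduced_intro _ _ _ _ _ p) => //.
  + by move=> i i' lt_ii' eb; rewrite !permE; exact: p_sorted.
  + by move=> i j lt_ji; rewrite mxE U_up// rmorph0.
  + by rewrite -redGA -map_col_perm -map_mxM; exact: map_LImx.
Qed.

Definition rep_lattice (p : 'S_n * rep_digits k I r) : set 'rV[o]_n :=
  lattice pi I r r0 (col_perm p.1 (rep p.2)).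

Definition good_rep (p : 'S_n * rep_digits k I r) : bool :=
  `[< BI_cond pi I r r0 (rep p.2) >] &&
  I_reduced I (col_perm p.1 (map_mx red (rep p.2))).

Lemma col_perm_unit (s : 'S_n) A : (col_perm s A \in unitmx) = (A \in unitmx).
Proof. by rewrite col_permE unitmx_mul unitmx_perm andbT. Qed.

(** [B] and [X *m B] have the same lattice, and the condition only expresses its closure under
    multiplication. *)
Lemma BI_cond_stab X B : LImx I X -> LImx I B -> stabmx pi I r X ->
  BI_cond pi I r r0 (X *m B) <-> BI_cond pi I r r0 B.
Proof.
move=> X_I B_I X_st; rewrite !(BI_mul_closed o_dvr)//; last exact: LI_mulmx.
by rewrite lattice_stab//; exact: LImx_unit X_I.
Qed.

(** The reduction is both block upper triangular and in [L_I], so reduction modulo [pi] is constant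
    on the cosets of [K]. *)
Lemma red_stabmx X : LImx I X -> stabmx pi I r X -> map_mx red X = 1%:M.
Proof.
move=> X_I X_st; apply: upper_LI_id; last exact: map_LImx.
exact: stabmx_red_upper red_residue r_pos X_st.
Qed.

(** Equal lattices make the quotient [G] of the two matrices stabilizing, so its reduction is block
    upper triangular and the permutations agree by [I_reduced_uniq]. Then [G] lies in [K] and
    [repmx_uniq] concludes. *)
Lemma rep_lattice_inj : {in good_rep &, injective rep_lattice}.
Proof.
move=> [s a] [s' b] /andP[_ red_a] /andP[_ red_b] /esym e.
have LIrep c : LImx I (rep c) by exact: repmx_LI.
have ua : col_perm s (rep a) \in unitmx by rewrite col_perm_unit;
  exact: LImx_unit (LIrep a).
have G_st := lattice_inj o_dvr ua e.
set G := _ *m _ in G_st.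
have GE : G *m col_perm s (rep a) = col_perm s' (rep b) by rewrite /G mulmxKV.
have ss' : s = s'.
  apply: (@I_reduced_uniq _ I _ (map_mx red G) _ _ s s' _ _ _ red_a red_b).
  - exact: stabmx_red_upper red_residue r_pos G_st.
  - exact: map_LImx.
  - exact: map_LImx.
  - by rewrite -!map_col_perm -map_mxM GE.
subst s'; have GE' : G *m rep a = rep b.
  move: GE; rewrite !col_permE mulmxA.
  exact: (can_inj (mulmxK (unitmx_perm _ _))).
congr (_, _); apply: (repmx_uniq o_dvr red_residue secK _ G_st GE').
by apply: (LImx_quot (LIrep a)); rewrite GE'.
Qed.

(** Two stabilizing factors normalize a lattice: [G] from [LI_reduction], then [X] from
    [repmx_exists]. The latter reduces to the identity, so being [I]-reduced passes to the
    representative. *)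
Lemma h_setE : h_set pi I r0 r = rep_lattice @` [set p | good_rep p].
Proof.
have LIrep c : LImx I (rep c) by exact: repmx_LI.
apply/seteqP; split=> [L [[_ _ L_cl] [A uA LE]]|L [[s a] /andP[/asboolP a_BI red_a] <-]].
  have {}LE : L = lattice pi I r r0 A by [].
  have [G [s [B [G_up uG B_I GA red_B]]]] := LI_reduction uA.
  have [X [a [X_I X_st XB]]] := repmx_exists red_residue secK r B_I.
  have LB : L = lattice pi I r r0 (col_perm s B).
    by rewrite LE -GA lattice_stab//; exact: stabmx_upper.
  have La : L = rep_lattice (s, a).
    rewrite LB /rep_lattice /rep -XB /= !col_permE -mulmxA.
    by rewrite [RHS]lattice_stab//; exact: LImx_unit X_I.
  exists (s, a); last by rewrite La.
  rewrite /= /good_rep /= {2}/rep -XB map_mxM red_stabmx// mul1mx red_B andbT.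
  apply/asboolP; apply/(BI_mul_closed o_dvr)=> //.
  by apply/(mul_closed_col_perm pi I r r0 s); rewrite -[lattice _ _ _ _ _]La.
have us : col_perm s (rep a) \in unitmx by rewrite col_perm_unit;
  exact: LImx_unit (LIrep a).
split; last by exists (col_perm s (rep a)).
split.
- exact: row_span_submodule.
- exact: finite_index_lattice red_residue us.
- apply: (mul_closed_col_perm pi I r r0 s (rep a)).2.
  exact/(BI_mul_closed o_dvr).
Qed.

(** Once the reduction [E] is fixed, the condition on [s] and the one on [a] are independent. *)
Lemma card_good_rep : #|[pred p | good_rep p]| =
  (\sum_(E | LImx I E) tau I E *
     #|[pred a | `[< BI_cond pi I r r0 (rep a) >] & map_mx red (rep a) == E]|)%N.
Proof.
rewrite -sum1_card.
rewrite (partition_big (fun p => map_mx red (rep p.2)) (fun E => LImx I E))/=; last first.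
  by move=> p _; apply/map_LImx/repmx_LI.
apply: eq_bigr => E _; rewrite sum1_card /tau -cardX; apply: eq_card => -[s a].
rewrite !inE /good_rep /= -topredE /=; case: eqP => [<-|_]; last by rewrite !andbF.
by rewrite !andbT andbC.
Qed.

End Enumeration.

(** * Haar measure of the cosets of [K] *)

Section Haar.
Variables (R : realType) (o : topIdomainType) (pi : o) (o_dvr : compact_dvr pi).
Variables (k : finFieldType) (red : {rmorphism o -> k}).
Variable red_residue : residue_map pi red.
Variables (sec : k -> o) (secK : cancel sec red).
Variables (n : nat) (I : {set 'I_n}) (r0 : nat) (r : 'I_n -> nat).
Variable r_pos : forall s, s \in I -> (0 < r s)%N.
Variables (mu : probability (LI_borel I o) R) (mu_haar : is_haar mu).

Let rep (a : rep_digits k I r) : 'M[o]_n := repmx pi sec a.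

(** For [A] and [B] in [L_I(o)] this is the set [A^-1 K B]. *)
Definition stab_coset (A B : 'M[o]_n) : set (LI_borel I o) :=
  [set C | stabmx pi I r (A *m val (C : LI_group I o) *m invmx B)].

Lemma measurable_stab_coset A B : measurable (stab_coset A B).
Proof.
apply: sub_sigma_algebra.
exists [set M | stabmx pi I r (A *m M *m invmx B)]; last by [].
(* Openness: every gap is at most [m], so changing the entries of [M] by multiples of [pi ^+ m]
   keeps the condition. *)
rewrite openE => M M_st; set m := (\sum_(s in I) r s)%N.
exists (fun i j => [set y | dvdr (pi ^+ m) (y - M i j)]).
  by move=> i j; apply/(dvr_adic o_dvr); exists m.
move=> M' M'P i j; rewrite /= -[M'](subrK M) mulmxDr mulmxDl mxE.
apply: dvdrD => //; rewrite mxE; apply: dvdr_sum => l _; apply: dvdr_mulr.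
rewrite mxE; apply: dvdr_sum => l' _; apply: dvdr_mull.
apply: (@dvdr_trans _ _ (pi ^+ m)); first exact/dvdr_exp/gap_le.
by have := M'P l' l; rewrite /= !mxE.
Qed.

Definition LI_inv (B : LI_group I o) : LI_group I o :=
  exist _ (invmx (val B)) (LImx_inv (valP B)).

Let repG (a : rep_digits k I r) : LI_group I o :=
  exist _ (rep a) (repmx_LI pi sec a).

Lemma translate_stab_coset a (B : LI_group I o) :
  LI_mul (LI_inv (repG a)) @` stab_coset 1%:M (val B) = stab_coset (rep a) (val B).
Proof.
have ua : rep a \in unitmx by apply: LImx_unit (repmx_LI pi sec a).
apply/seteqP; split=> [_ [X X_st <-]|C C_st].
  by move: X_st; rewrite /stab_coset /= mulKVmx// mul1mx.
exists (LI_mul (repG a) C); first by rewrite /stab_coset /= mul1mx.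
by apply/val_inj; rewrite /= mulKmx.
Qed.

(* The translates of a coset by the inverses of the representatives partition
   the group, so left invariance suffices although these are right cosets. *)
Lemma haar_stab_coset (B : LI_group I o) :
  mu (stab_coset 1%:M (val B)) = ((#|rep_digits k I r|%:R)^-1)%:E.
Proof.
have B_I := valP B; have uB := LImx_unit B_I.
pose F a := stab_coset (rep a) (val B).
have muF a : mu (F a) = mu (stab_coset 1%:M (val B)).
  by rewrite /F -translate_stab_coset mu_haar//; exact: measurable_stab_coset.
have F_triv : trivIset setT F.
  move=> a b _ _ [C [Ca Cb]]; have C_I := valP (C : LI_group I o).
  set g := val (C : LI_group I o) *m invmx (val B).
  have g_I : LImx I g by apply: LI_mulmx => //; exact: LImx_inv.
  have [ug ua] := (LImx_unit g_I, LImx_unit (repmx_LI pi sec a)).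
  have [Xa_I Xb_I] : LImx I (rep a *m g) /\ LImx I (rep b *m g).
    by split; apply: LI_mulmx => //; exact: repmx_LI.
  have Xa_st : stabmx pi I r (rep a *m g) by rewrite /g mulmxA; exact: Ca.
  have Xb_st : stabmx pi I r (rep b *m g) by rewrite /g mulmxA; exact: Cb.
  have uXa := LImx_unit Xa_I.
  (* If [C] lies in both translates, [rep a *m g] and [rep b *m g] are in [K], and their quotient
     carries [rep a] to [rep b]. *)
  apply: (repmx_uniq o_dvr red_residue secK
    (X := rep b *m g *m invmx (rep a *m g))).
  - by apply: LI_mulmx => //; exact: LImx_inv.
  - by apply: (stabmxM o_dvr) => //; exact: (stabmxV o_dvr).
  - rewrite -[X in _ *m X = _](mulmxK ug) -/(rep a) mulmxA mulmxKV//.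
    by rewrite mulmxK.
have F_cover : \bigcup_(a in [set a | predT a]) F a = setT.
  rewrite -subTset => C _; have C_I := valP (C : LI_group I o).
  set g := val (C : LI_group I o) *m invmx (val B).
  have g_I : LImx I g by apply: LI_mulmx => //; exact: LImx_inv.
  (* Representing the inverse of [g] as [X *m invmx g = rep a] gives [rep a *m g = X], an element of
     [K]. *)
  have [X [a [X_I X_st Xa]]] := repmx_exists red_residue secK r (LImx_inv g_I).
  exists a => //; rewrite /F /stab_coset /= -mulmxA -/g /rep -Xa mulmxKV//.
  exact: LImx_unit g_I.
have := @measure_bigcup_fin _ _ _ mu _ predT _ (fun a =>
  measurable_stab_coset _ _) F_triv.
rewrite F_cover (eq_bigr _ (fun a _ => muF a)) [LHS](probability_setT mu).
set x := mu _; have x_fin : x \is a fin_num by exact: fin_num_measure (measurable_stab_coset _ _).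
rewrite -(fineK x_fin) sumEFin => -[e]; congr EFin.
have {}e : 1 = #|rep_digits k I r|%:R * fine x by rewrite mulr_natl -sumr_const.
have nz : (#|rep_digits k I r|%:R : R) != 0.
  by apply: contra_eq_neq e => ->; rewrite mul0r oner_eq0.
by apply: (mulfI nz); rewrite -e mulfV.
Qed.

(** Both the divisibility condition and the reduction are invariant under left multiplication by
    [K], so the set is a union of cosets. *)
Lemma BI_reducesE E :
  BI pi I r0 r `&` reduces_to I red E =
  \bigcup_(a in [set a | `[< BI_cond pi I r r0 (rep a) >] && (map_mx red (rep a) == E)])
    stab_coset 1%:M (rep a).
Proof.
have repI a : LImx I (rep a) by exact: repmx_LI.
apply/seteqP; split=> [C [C_BI C_E]|C [a /andP[/asboolP a_BI /eqP a_E]]].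
  have C_I := valP (C : LI_group I o).
  have [X [a [X_I X_st Xa]]] := repmx_exists red_residue secK r C_I.
  have uX := LImx_unit X_I; exists a.
    apply/andP; split; last by rewrite /rep -Xa map_mxM (red_stabmx red_residue r_pos X_I X_st) mul1mx C_E.
    by apply/asboolP; rewrite /rep -Xa; apply/BI_cond_stab.
  rewrite /stab_coset /= mul1mx -[val _](mulKmx uX) Xa mulmxK;
    last exact: LImx_unit (repI a).
  exact: (stabmxV o_dvr).
rewrite /stab_coset /= mul1mx; have C_I := valP (C : LI_group I o).
set X := _ *m _ => X_st.
have X_I : LImx I X by apply: LI_mulmx => //; exact: LImx_inv.
have CE : val (C : LI_group I o) = X *m rep a.
  by rewrite /X mulmxKV//; exact: LImx_unit (repI a).
split; first by move: a_BI => /(BI_cond_stab o_dvr r0 X_I (repI a) X_st); rewrite -CE.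
by rewrite /reduces_to /= CE map_mxM (red_stabmx red_residue r_pos X_I X_st) mul1mx.
Qed.

Lemma haar_BI_reduces E :
  (\int[mu]_(B in BI pi I r0 r `&` reduces_to I red E) 1 =
   (#|[pred a | `[< BI_cond pi I r r0 (rep a) >] & map_mx red (rep a) == E]|%:R
     / #|rep_digits k I r|%:R)%:E)%E.
Proof.
rewrite BI_reducesE.
set P := [set a | _].
have mF a : measurable (stab_coset 1%:M (rep a)) by exact: measurable_stab_coset.
have F_triv : trivIset setT (fun a => stab_coset 1%:M (rep a)).
  move=> a b _ _ [C []]; rewrite /stab_coset /= !mul1mx => Ca Cb.
  have C_I := valP (C : LI_group I o).
  have [a_I b_I] := (repmx_LI pi sec a, repmx_LI pi sec b).
  have [ua ub] := (LImx_unit a_I, LImx_unit b_I); have uC := LImx_unit C_I.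
  have Xa_I : LImx I (val (C : LI_group I o) *m invmx (rep a)).
    by apply: LI_mulmx => //; exact: LImx_inv.
  have Xb_I : LImx I (val (C : LI_group I o) *m invmx (rep b)).
    by apply: LI_mulmx => //; exact: LImx_inv.
  apply: (repmx_uniq o_dvr red_residue secK (X := invmx (val (C : LI_group I o)
      *m invmx (rep b)) *m (val (C : LI_group I o) *m invmx (rep a)))).
  - by apply: LI_mulmx => //; exact: LImx_inv.
  - apply: (stabmxM o_dvr) => //; apply: (stabmxV o_dvr) => //.
    exact: LImx_unit Xb_I.
  - rewrite -mulmxA mulmxKV//.
    apply: (can_inj (mulKmx (LImx_unit Xb_I))); rewrite mulKVmx ?mulmxKV//.
    exact: LImx_unit Xb_I.
have mS : measurable (\bigcup_(a in P) stab_coset 1%:M (rep a)).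
  by apply: fin_bigcup_measurable => //; exact: finite_finset.
rewrite [LHS](integral_cst mu mS) mul1e measure_bigcup_fin//.
rewrite (eq_bigr (fun=> (#|rep_digits k I r|%:R^-1)%:E)); last first.
  move=> a _; exact: (haar_stab_coset (exist _ (rep a) (repmx_LI pi sec a))).
by rewrite sumEFin sumr_const mulr_natl.
Qed.
End Haar.

(** * Comparison of the lattice count with the integral *)

Theorem proposition2p11 (R : realType)
    (o : topIdomainType) (pi : o) (o_dvr : compact_dvr pi)
    (k : finFieldType) (red : {rmorphism o -> k})
    (red_residue : residue_map pi red)
    (n : nat) (n_ge2 : (2 <= n)%N)
    (I : {set 'I_n}) (I_neq0 : I != finset.set0)
    (I_pos : forall s : 'I_n, s \in I -> (0 < s)%N)
    (r0 : nat) (r : 'I_n -> nat)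
    (r_pos : forall s : 'I_n, s \in I -> (0 < r s)%N)
    (mu : probability (LI_borel I o) R) (mu_haar : is_haar mu) :
  finite_set (h_set pi I r0 r) /\
  ((h_n pi I r0 r)%:R%:E =
   (#|k| ^ (\sum_(s in I) r s * s * (n - s)))%:R%:E *
   \sum_(E : 'M[k]_n | LImx I E)
      ((tau I E)%:R%:E *
       \int[mu]_(B in BI pi I r0 r `&` reduces_to I red E) 1)
   :> \bar R)%E.
Proof.
have [sec secK] := choice (residue_surj red_residue).
rewrite /h_n (h_setE o_dvr red_residue secK r0 r_pos).
split; first exact/finite_image/finite_finset.
rewrite card_fset_set_image; last exact: rep_lattice_inj.
rewrite (card_good_rep pi red sec I r0 r) -(card_rep_digits k I r).
pose q (E : 'M[k]_n) := #|[pred a : rep_digits k I r | `[< BI_cond pi I r r0 (repmx pi sec a) >] &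
  map_mx red (repmx pi sec a) == E]|.
rewrite [X in (_ * X)%E](eq_bigr (fun E =>
    ((tau I E)%:R * ((q E)%:R / #|rep_digits k I r|%:R))%:E)); last first.
  move=> E _; rewrite EFinM; congr (_ * _)%E.
  exact: (haar_BI_reduces o_dvr red_residue secK r0 r_pos mu_haar E).
(* The power of [#|k|] is the number of cosets and cancels the measure of one coset, so the sums
   agree term by term in [E]. *)
rewrite sumEFin -EFinM; congr EFin.
rewrite natr_sum mulr_sumr; apply: eq_bigr => E _.
have nz : (#|rep_digits k I r|%:R : R) != 0.
  by rewrite pnatr_eq0 -lt0n; apply/card_gt0P; exists [ffun=> 0].
by rewrite natrM mulrCA; congr (_ * _); rewrite mulrC divfK.
Qed.
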